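(* Let $E,F:\mathbb{H}\to\mathbb{R}$ and $G=E+F$, where $G$ is $\mu$-strongly convex ($\mu>0$) with locally Lipschitz continuous derivative with respect to the $\mathcal{L}$-norm. Let $\{v_k\}_{k\ge1}\subset\mathbb{H}$ be obtained via the PPGD method with preconditioner $\mathcal{L}$, initial guess $v_0\in\mathbb{H}$, step size $\beta>0$, and a family $\{A(\cdot;\theta)\mid\theta\in\Theta\}$ whose perturbations uniformly vanish. Let $u:=\operatorname{argmin}_{v\in\mathbb{H}}G(v)$, $d_0:=\|v_0-u\|_{\mathcal{L}}$, $$B:=\{v\in\mathbb{H}\mid\|v-u\|_{\mathcal{L}}\le d_0\},$$ let $C_{B1},C_{B2}>0$ be the dual trap constants of $G$ on $B$, and define $$\beta_0:=\min\{C_{B2},C_{B1}^{-1}\},\qquad \epsilon_0:=\left(\frac{1}{C_{B1}}+\frac{5C_{B2}}{4}\right)^{-1}d_0^2\,C_{B1}.$$ If $\beta\in(0,\beta_0]$ and the solver parameters $\{\theta_k\}_{k\ge0}\subset\Theta$ are chosen such that the perturbations $\eta_k$ satisfy $\|\eta_k\|_{\mathcal{L}^{-1}}^2\le\epsilon_0$ for all $k\ge0$ (as is guaranteed to be possible by the uniform vanishing property), then for all $k\in\mathbb{N}$ the iterates satisfy $v_k\in B$.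
   Context: $\mathbb{H}$ is a real separable Hilbert space with dual $\mathbb{H}^*$ and duality pairing $\langle\cdot,\cdot\rangle$. $\mathcal{B}(\mathbb{H},\mathbb{H}^* )$ is the space of bounded linear maps $\mathbb{H}\to\mathbb{H}^*$. All functionals $\mathbb{H}\to\mathbb{R}$ are assumed continuously Fréchet differentiable; $\delta$ denotes the Fréchet derivative. A preconditioner is $\mathcal{L}\in\mathcal{B}(\mathbb{H},\mathbb{H}^* )$ such that $(u,v)_{\mathcal{L}}:=\langle\mathcal{L}u,v\rangle$ is symmetric and there are $C_1,C_2>0$ with $(u,v)_{\mathcal{L}}\le C_2\|u\|_{\mathbb{H}}\|v\|_{\mathbb{H}}$ and $C_1\|u\|_{\mathbb{H}}^2\le(u,u)_{\mathcal{L}}$. Write $\|v\|_{\mathcal{L}}:=\sqrt{(v,v)_{\mathcal{L}}}$ for $v \in \mathbb{H}$ and $\|\phi\|_{\mathcal{L}^{-1}}:=\sqrt{\langle\phi,\mathcal{L}^{-1}\phi\rangle}$ for $\phi\in\mathbb{H}^*$. $G$ is $\mu$-strongly convex if $\langle\delta G(u)-\delta G(v),u-v\rangle\ge\mu\|u-v\|_{\mathcal{L}}^2$ for all $u,v\in\mathbb{H}$ (then $G$ has a unique minimizer). $G$ has locally Lipschitz continuous derivative if for every bounded convex $B'\subset\mathbb{H}$ there is $L_{B'}>0$ with $\|\delta G(u)-\delta G(v)\|_{\mathcal{L}^{-1}}\le L_{B'}\|u-v\|_{\mathcal{L}}$ for all $u,v\in B'$. Dual trap constants of $G$ on a bounded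 convex set $B$: let $\tilde G(v)=G(v)-\frac{\mu}{4}\|v\|_{\mathcal{L}}^2$ and let $\hat L_B>0$ be a constant such that $\frac{1}{\hat L_B}\|\delta\tilde G(v)-\delta\tilde G(w)\|_{\mathcal{L}^{-1}}^2\le\langle\delta\tilde G(v)-\delta\tilde G(w),v-w\rangle$ for all $v,w\in B$ (such a constant exists). Then $C_{B1}:=\frac{\mu^2+2\mu\hat L_B}{4\hat L_B+4\mu}$ and $C_{B2}:=\frac{1}{\mu+\hat L_B}$; with these, $\langle\delta G(v)-\delta G(w),v-w\rangle\ge C_{B1}\|v-w\|_{\mathcal{L}}^2+C_{B2}\|\delta G(v)-\delta G(w)\|_{\mathcal{L}^{-1}}^2$ for all $v,w\in B$. PPGD (perturbed preconditioned gradient descent): $\Theta$ is a directed set of solver parameters with ordering $\preceq$, and $\{A(\cdot;\theta)\mid\theta\in\Theta\}\subset\mathcal{B}(\mathbb{H},\mathbb{H}^* )$ is a family of approximations of $\delta F$. Given $v_0\in\mathbb{H}$, step size $\beta>0$ and parameters $\theta_k\in\Theta$, the iterates are $$v_{k+1}=v_k-\beta\mathcal{L}^{-1}(\delta G(v_k)+\eta_k),\qquad \eta_k:=A(v_k;\theta_k)-\delta F(v_k),\qquad k\ge0.$$ With $\eta_{v,\theta}:=A(v;\theta)-\delta F(v)$, the perturbations uniformly vanish if for any bounded $B'\subset\mathbb{H}$ and any $\epsilon>0$ there is $\theta_0\in\Theta$ such that $\sup_{v\in B'}\|\eta_{v,\theta}\|_{\mathcal{L}^{-1}}\le\epsilon$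 for all $\theta$ with $\theta_0\preceq\theta$.
   Formalization: The parenthetical that admissible solver parameters can always be chosen is proved only when d_0 > 0; if v_0 = u then ε_0 = 0 and uniform vanishing need not give an exactly zero perturbation. The main claim v_k ∈ B is unrestricted. *)

(* Defs.v *)
From HB Require Import structures.
From mathcomp Require Import all_boot all_order all_algebra.
From mathcomp Require Import all_classical all_reals all_analysis.

Set Implicit Arguments.
Unset Strict Implicit.
Unset Printing Implicit Defensive.

Import Order.TTheory GRing.Theory Num.Theory.
Import numFieldNormedType.Exports.

Local Open Scope classical_set_scope.
Local Open Scope ring_scope.

(* Elements of the dual H^* are represented by their underlying functions
   H -> R, so that the duality pairing <phi, v> is the application [phi v] and
   a map T : H -> H^* is a function of two arguments, <T u, v> = [T u v]. *)

(* A real Hilbert space is a complete normed module over R whose norm comes from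
   an inner product. *)
Definition norm_of_inner_product (R : realType) (H : normedModType R)
    (ip : {dot H for (@idfun R)}) : Prop :=
  forall x : H, `|x| ^+ 2 = ip x x.

Definition separable_space (T : topologicalType) : Prop :=
  exists2 D : set T, countable D & dense D.

Definition directed_set (T : Type) (le : T -> T -> Prop) : Prop :=
  [/\ inhabited T,
      forall x, le x x,
      forall x y z, le x y -> le y z -> le x z &
      forall x y, exists z, le x z /\ le y z].

Section Functionals.
Context {R : realType} {H : normedModType R}.

(* B(H, H^* ): the bound says that T u is a bounded functional with
   ||T u|| <= M ||u||. *)
Definition bounded_operator (T : H -> H -> R) : Prop :=
  bilinear_for *%R *%R T /\
  exists M : R, forall u v : H, `|T u v| <= M * `|u| * `|v|.

(* The Fréchet derivative delta G : H -> H^*. *)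
Definition deriv (G : H -> R) (v : H) : H -> R := 'd (G : H -> R^o) v.

(* Continuity of v |-> delta G(v) is with respect to the dual norm: the bound
   quantified over h reads ||delta G(w) - delta G(v)||_{H^*} <= e. *)
Definition continuously_differentiable (G : H -> R) : Prop :=
  (forall v : H, differentiable (G : H -> R^o) v) /\
  (forall (v : H) (e : R), 0 < e ->
     \forall w \near v, forall h : H, `|deriv G w h - deriv G v h| <= e * `|h|).

Definition minimizer (G : H -> R) (u : H) : Prop := forall v : H, G u <= G v.

Definition preconditioner (L : H -> H -> R) : Prop :=
  [/\ bounded_operator L,
      forall u v : H, L u v = L v u,
      exists2 C2 : R, 0 < C2 & forall u v : H, L u v <= C2 * `|u| * `|v| &
      exists2 C1 : R, 0 < C1 & forall u : H, C1 * `|u| ^+ 2 <= L u u].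

(* L^{-1} : H^* -> H; total, with the value 0 outside the range of L. *)
Definition Linv (L : H -> H -> R) (phi : H -> R) : H :=
  xget 0 [set w : H | L w = phi].

Definition Lnorm_primal (L : H -> H -> R) (v : H) : R := Num.sqrt (L v v).

Definition Lnorm_dual (L : H -> H -> R) (phi : H -> R) : R :=
  Num.sqrt (phi (Linv L phi)).

Definition strongly_convex (L : H -> H -> R) (mu : R) (G : H -> R) : Prop :=
  forall u v : H,
    mu * Lnorm_primal L (u - v) ^+ 2 <= (deriv G u \- deriv G v) (u - v).

Definition locally_lipschitz_deriv (L : H -> H -> R) (G : H -> R) : Prop :=
  forall B : set H, bounded_set B -> convex_set (B : set (convex_lmodType H)) ->
    exists2 lip : R, 0 < lip & forall u v : H, B u -> B v ->
      Lnorm_dual L (deriv G u \- deriv G v) <= lip * Lnorm_primal L (u - v).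

Definition Gtilde (L : H -> H -> R) (mu : R) (G : H -> R) : H -> R :=
  fun v => G v - mu / 4 * Lnorm_primal L v ^+ 2.

(* The defining property of the constant \hat L_B from which the dual trap
   constants C_{B1}, C_{B2} are computed. *)
Definition cocoercivity_constant (L : H -> H -> R) (mu : R) (G : H -> R)
    (B : set H) (Lhat : R) : Prop :=
  0 < Lhat /\
  forall v w : H, B v -> B w ->
    let dG := deriv (Gtilde L mu G) v \- deriv (Gtilde L mu G) w in
    1 / Lhat * Lnorm_dual L dG ^+ 2 <= dG (v - w).

Definition dual_trap1 (mu Lhat : R) : R :=
  (mu ^+ 2 + 2 * mu * Lhat) / (4 * Lhat + 4 * mu).

Definition dual_trap2 (mu Lhat : R) : R := 1 / (mu + Lhat).

Definition perturbation (Theta : Type) (A : Theta -> H -> H -> R) (F : H -> R)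
    (v : H) (theta : Theta) : H -> R :=
  A theta v \- deriv F v.

Definition uniformly_vanish (L : H -> H -> R) (Theta : Type)
    (le : Theta -> Theta -> Prop) (A : Theta -> H -> H -> R) (F : H -> R) : Prop :=
  forall (B : set H) (e : R), bounded_set B -> 0 < e ->
    exists theta0 : Theta, forall theta : Theta, le theta0 theta ->
      (ereal_sup [set (Lnorm_dual L (perturbation A F v theta))%:E | v in B]
         <= e%:E)%E.

Fixpoint ppgd (L : H -> H -> R) (G F : H -> R) (Theta : Type)
    (A : Theta -> H -> H -> R) (beta : R) (v0 : H) (theta : nat -> Theta)
    (k : nat) : H :=
  match k with
  | 0%N => v0
  | k'.+1 =>
      let v := ppgd L G F A beta v0 theta k' in
      v - beta *: Linv L (deriv G v \+ perturbation A F v (theta k'))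
  end.

End Functionals.

(* Main.v *)
Require Import Defs.
From HB Require Import structures.
From mathcomp Require Import all_boot all_order all_algebra.
From mathcomp Require Import all_classical all_reals all_analysis.
From mathcomp Require Import ring lra.
Set Implicit Arguments.
Unset Strict Implicit.
Unset Printing Implicit Defensive.
Import Order.TTheory GRing.Theory Num.Theory.
Import numFieldNormedType.Exports.
Import Defs.
Local Open Scope classical_set_scope.
Local Open Scope ring_scope.

(** Write |.| for the norm of the inner product (x, y) = L x y.  By the Riesz
theorem [riesz_preconditioner] every bounded functional is L w for exactly one w;
hence L^-1 behaves as a genuine inverse, the dual norm of L w is |w|, and a PPGD
step reads e' = e - beta (g + p), where e = v - u is the error and g and p
represent the gradient of G at v and the perturbation.

The gradient of G vanishes at the minimizer u, so the cocoercivity of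
G - mu/4 |.|^2 between v and u is, after completing the square, the dual trap
inequality (g, e) >= CB1 |e|^2 + CB2 |g|^2 ([gradient_dual_trap]).  If
beta <= CB2, the term beta^2 |g|^2 in the expansion of |e - beta g|^2 is absorbed
by the CB2 part of this inequality, and therefore
  |e - beta g|^2 <= (1 - 2 beta CB1) |e|^2 <= (1 - beta CB1)^2 |e|^2.
The unperturbed step thus contracts the error by 1 - beta CB1, which is nonnegative
as beta <= 1 / CB1.  The bound eps0 <= (CB1 d0)^2 gives |beta p| <= beta CB1 d0,
exactly the radius that the contraction frees: by the triangle inequality,
|e'| <= (1 - beta CB1) d0 + beta CB1 d0 = d0 ([perturbed_step_in_ball]).  The
iterates stay in B by induction.

For the existence of admissible parameters, B is bounded and eps0 > 0, so uniform
vanishing on B gives one parameter theta0 that keeps the perturbation small at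
every point of B.  The constant sequence theta0 is admissible: the iterates
remain in B because the perturbations met so far are small, and the next
perturbation is small because the iterate is in B. *)

(** * Bounded functionals and Fréchet derivatives *)

Definition bounded_functional (R : realType) (H : normedModType R)
    (phi : H -> R) : Prop :=
  scalar phi /\ exists M : R, forall v, `|phi v| <= M * `|v|.

Section BoundedFunctionals.
Context {R : realType} {H : normedModType R}.
Implicit Types phi psi : H -> R.

Lemma bounded_functionalD phi psi :
  bounded_functional phi -> bounded_functional psi ->
  bounded_functional (phi \+ psi).
Proof.
move=> [lphi [M Mphi]] [lpsi [N Npsi]]; split.
  by move=> a x y /=; rewrite lphi lpsi /=; ring.
exists (M + N) => x /=; rewrite mulrDl.
exact: le_trans (ler_normD _ _) (lerD (Mphi x) (Npsi x)).
Qed.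

Lemma bounded_functionalN phi :
  bounded_functional phi -> bounded_functional (\- phi).
Proof.
move=> [lphi [M Mphi]]; split; first by move=> a x y /=; rewrite lphi /=; ring.
by exists M => x /=; rewrite normrN.
Qed.

Lemma bounded_functionalB phi psi :
  bounded_functional phi -> bounded_functional psi ->
  bounded_functional (phi \- psi).
Proof. by move=> hphi /bounded_functionalN; exact: bounded_functionalD. Qed.

(** Elements of the dual are bare functions here; bundling phi as a linear map gives
access to the equivalence of boundedness and continuity. *)
Lemma bounded_functional_continuous phi :
  bounded_functional phi -> continuous (phi : H -> R^o).
Proof.
move=> [lphi [M Mphi]].
pose f : {linear H -> R^o} := HB.pack_for {linear H -> R^o} (phi : H -> R^o)
  (GRing.isLinear.Build R H R^o *:%R (phi : H -> R^o) lphi).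
suff : continuous f by [].
apply/linear_bounded_continuous/linear_boundedP; near=> r => x.
by apply: le_trans (Mphi x) _; apply: ler_wpM2r.
Unshelve. all: by end_near. Qed.

Lemma bounded_functional_deriv (f : H -> R) (v : H) :
  differentiable (f : H -> R^o) v -> bounded_functional (deriv f v).
Proof.
move=> df; split; first by move=> a x y; exact: (linearP ('d (f : H -> R^o) v)).
have [k _ hk] := linear_lipschitz (diff_continuous df).
by exists k => x; exact: hk.
Qed.

(** A remainder of order |h|^2 is o(h); this is the form in which quadratic
functionals present themselves. *)
Lemma quadratic_remainder_is_diff (f phi : H -> R) (C : R) (x : H) :
  bounded_functional phi ->
  (forall h, `|f (h + x) - (f x + phi h)| <= C * `|h| ^+ 2) ->
  is_diff x (f : H -> R^o) phi.
Proof.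
move=> bphi hC; have [lphi _] := bphi.
pose df : {linear H -> R^o} := HB.pack_for {linear H -> R^o} (phi : H -> R^o)
  (GRing.isLinear.Build R H R^o *:%R (phi : H -> R^o) lphi).
have dfc : continuous df := bounded_functional_continuous bphi.
have dxf : (f : H -> R^o) \o shift x = cst (f x : R^o) + df +o_ 0 id.
  apply/eqaddoP => e e0; near=> h => /=.
  apply: le_trans (hC h) _; rewrite expr2 mulrA; apply: ler_wpM2r => //.
  have C1 : 0 < `|C| + 1 by rewrite ltr_wpDl.
  apply: (@le_trans _ _ ((`|C| + 1) * `|h|)).
    by apply: ler_wpM2r => //; apply: le_trans (ler_norm _) _; rewrite lerDl.
  rewrite mulrC -ler_pdivlMr//.
  near: h; apply/nbhs_norm0P; exists (e / (`|C| + 1)) => /=.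
    by rewrite divr_gt0.
  by move=> y /=; rewrite ?sub0r ?normrN => /ltW.
have dE := diff_unique dfc dxf.
apply: DiffDef => //; apply/diff_locallyP; rewrite dE; split => //.
Unshelve. all: by end_near. Qed.

(** Fermat's rule, obtained along each line through u from the one-variable
statement. *)
Lemma deriv_minimizer (f : H -> R) (u : H) :
  (forall v, differentiable (f : H -> R^o) v) -> minimizer f u ->
  deriv f u = \0.
Proof.
move=> df fmin; apply/funext => h.
rewrite /deriv -(deriveE h (df u)).
pose g (t : R) : R := f (t *: h + u).
have dg t : derivable (g : R -> R^o) t 1.
  apply: diff_derivable.
  by apply: (differentiable_comp (f := fun t : R => t *: h + u)).
have g_min : is_derive (0 : R) (1 : R) (g : R -> R^o) 0.
  apply: (@derive1_at_min R g (- 1) 1 0) => [|t _||t _].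
  - lra.
  - exact: dg.
  - by rewrite in_itv /= ltrN10 ltr01.
  - by rewrite /g scale0r add0r.
have <- : 'D_1 (g : R -> R^o) 0 = \0 h by rewrite derive_val.
rewrite /derive.
suff -> : (fun t : R => t^-1 *: (((f : H -> R^o) \o shift u) (t *: h) - f u)) =
    (fun t : R => t^-1 *: (((g : R -> R^o) \o shift 0) (t *: 1) - g 0)) by [].
apply/funext => t /=; by rewrite /g addr0 scale0r add0r [_%:A]mulr1.
Qed.

End BoundedFunctionals.

(** * The inner product and norms of a preconditioner *)

Section Preconditioner.
Context {R : realType} {H : normedModType R} {L : H -> H -> R}.
Context (hL : preconditioner L).
Implicit Types x y z : H.

Lemma preconditionerC x y : L x y = L y x.
Proof. by case: hL => _ LC _ _; exact: LC. Qed.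

Lemma preconditioner_linr x : scalar (L x).
Proof. by case: hL => [[[_ Lr] _] _ _ _]; exact: Lr. Qed.

Lemma preconditionerDr x y z : L x (y + z) = L x y + L x z.
Proof. by have := preconditioner_linr x 1 y z; rewrite scale1r mul1r. Qed.

Lemma preconditioner0r x : L x 0 = 0.
Proof. by apply: (addrI (L x 0)); rewrite -preconditionerDr !addr0. Qed.

Lemma preconditionerZr x a y : L x (a *: y) = a * L x y.
Proof.
by have := preconditioner_linr x a y 0; rewrite /= preconditioner0r !addr0.
Qed.

Lemma preconditionerBr x y z : L x (y - z) = L x y - L x z.
Proof. by rewrite -scaleN1r preconditionerDr preconditionerZr mulN1r. Qed.

Lemma preconditionerDl x y z : L (x + y) z = L x z + L y z.
Proof. by rewrite preconditionerC preconditionerDr !(preconditionerC z). Qed.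

Lemma preconditionerZl a x y : L (a *: x) y = a * L x y.
Proof. by rewrite preconditionerC preconditionerZr preconditionerC. Qed.

Lemma preconditionerBl x y z : L (x - y) z = L x z - L y z.
Proof. by rewrite preconditionerC preconditionerBr !(preconditionerC z). Qed.

Definition preconditioner_expand :=
  (preconditionerBl, preconditionerBr, preconditionerDl, preconditionerDr,
   preconditionerZl, preconditionerZr).

Lemma preconditioner_ge0 x : 0 <= L x x.
Proof.
case: hL => _ _ _ [C C0 hC]; apply: le_trans (hC x).
by apply: mulr_ge0; [exact: ltW|exact: exprn_ge0].
Qed.

Lemma preconditioner_eq0 x : L x x = 0 -> x = 0.
Proof.
case: hL => _ _ _ [C C0 hC] x0; have := hC x; rewrite x0 pmulr_rle0// => x2.
by apply/eqP; rewrite -normr_eq0 -sqrf_eq0 eq_le x2 sqr_ge0.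
Qed.

Lemma preconditioner_inj : injective L.
Proof.
move=> x y xy; apply/eqP; rewrite -subr_eq0; apply/eqP/preconditioner_eq0.
by rewrite preconditionerBl xy subrr.
Qed.

Lemma bounded_functional_preconditioner x : bounded_functional (L x).
Proof.
split; first exact: preconditioner_linr.
by case: hL => [[_ [M hM]] _ _ _]; exists (M * `|x|).
Qed.

(** Expand the square of (y, y) x - (x, y) y, which is (y, y) times the difference of
the two sides. *)
Lemma preconditioner_cauchy_schwarz x y : L x y ^+ 2 <= L x x * L y y.
Proof.
have [/preconditioner_eq0 ->|y0] := eqVneq (L y y) 0.
  by rewrite !preconditioner0r expr0n mulr0.
have yy : 0 < L y y by rewrite lt_def y0 preconditioner_ge0.
have := preconditioner_ge0 (L y y *: x - L x y *: y).
rewrite !preconditioner_expand (preconditionerC y x).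
rewrite (_ : _ - _ = L y y * (L x x * L y y - L x y ^+ 2)); last by ring.
by rewrite pmulr_rge0// subr_ge0.
Qed.

Lemma Lnorm_primal_sqr x : Lnorm_primal L x ^+ 2 = L x x.
Proof. by rewrite sqr_sqrtr// preconditioner_ge0. Qed.

Lemma Lnorm_primal0 : Lnorm_primal L 0 = 0.
Proof. by rewrite /Lnorm_primal preconditioner0r sqrtr0. Qed.

Lemma Lnorm_primalB x y :
  Lnorm_primal L (x - y) <= Lnorm_primal L x + Lnorm_primal L y.
Proof.
rewrite -ler_sqr ?nnegrE ?addr_ge0 ?sqrtr_ge0//.
rewrite sqrrD !Lnorm_primal_sqr !preconditioner_expand (preconditionerC y x).
suff : - L x y <= Lnorm_primal L x * Lnorm_primal L y by lra.
rewrite /Lnorm_primal -sqrtrM ?preconditioner_ge0//.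
apply: le_trans (ler_norm _) _; rewrite normrN -sqrtr_sqr.
by rewrite ler_sqrt ?mulr_ge0 ?preconditioner_ge0// preconditioner_cauchy_schwarz.
Qed.

Lemma Lnorm_primalZ a x : Lnorm_primal L (a *: x) = `|a| * Lnorm_primal L x.
Proof.
by rewrite /Lnorm_primal !preconditioner_expand mulrA sqrtrM ?sqr_ge0// sqrtr_sqr.
Qed.

(** By coercivity the L-norm controls the norm of H, so that uniform vanishing
applies to balls of the L-norm. *)
Lemma bounded_Lnorm_ball x (r : R) :
  bounded_set [set y : H | Lnorm_primal L (y - x) <= r].
Proof.
case: hL => _ _ _ [C C0 hC].
exists (`|x| + Num.sqrt (r ^+ 2 / C)); split; first exact: num_real.
move=> M /ltW /(le_trans _) rM y /= yr; apply: rM.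
rewrite -[y](subrK x) addrC; apply: le_trans (ler_normD _ _) _.
rewrite lerD2l -(ger0_norm (normr_ge0 (y - x))) -sqrtr_sqr ler_wsqrtr//.
rewrite ler_pdivlMr// mulrC (le_trans (hC _))// -Lnorm_primal_sqr.
by rewrite ler_sqr ?nnegrE ?sqrtr_ge0// (le_trans _ yr) ?sqrtr_ge0.
Qed.

(** [Linv] picks some preimage; coercivity makes L injective, so on the range of L it
is the inverse. *)
Lemma LinvK : cancel L (Linv L).
Proof.
move=> x; apply: preconditioner_inj.
by apply: (@xgetPex _ 0 [set w : H | L w = L x]); exists x.
Qed.

Lemma Lnorm_dualE x : Lnorm_dual L (L x) = Lnorm_primal L x.
Proof. by rewrite /Lnorm_dual LinvK. Qed.

(** The remainder of |.|^2 at x is exactly (h, h). *)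
Lemma is_diff_Lnorm_sqr x :
  is_diff x ((fun y => Lnorm_primal L y ^+ 2) : H -> R^o) (2 \*: L x).
Proof.
case: hL => [[_ [M hM]] _ _ _].
apply: (@quadratic_remainder_is_diff _ _ _ _ M) => [|h].
  have -> : (2 \*: L x) = L (2 *: x).
    by apply/funext => h; rewrite /= preconditionerZl.
  exact: bounded_functional_preconditioner.
rewrite !Lnorm_primal_sqr !preconditioner_expand (preconditionerC h x) /=.
rewrite (_ : _ - _ = L h h); first by rewrite expr2 mulrA.
by rewrite -[2 *: _]/(2 * _); ring.
Qed.

Lemma deriv_Gtilde (mu : R) (G : H -> R) x :
  differentiable (G : H -> R^o) x ->
  deriv (Gtilde L mu G) x = deriv G x \- L ((mu / 2) *: x).
Proof.
move=> /differentiableP dG; have dq := is_diff_Lnorm_sqr x.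
have -> : (Gtilde L mu G : H -> R^o) =
    (G : H -> R^o) - (mu / 4) *: ((fun y => Lnorm_primal L y ^+ 2) : H -> R^o).
  by [].
rewrite /deriv [LHS]diff_val; apply/funext => h /=.
rewrite preconditionerZl; congr (_ - _).
by rewrite -[LHS]/(mu / 4 * (2 * L x h)); field.
Qed.

End Preconditioner.

(** * Riesz representation for a preconditioner *)

(** For b > 0 the quadratic is negative at t = - c / b unless c = 0; the choice
t = - c / (b + 1) also covers b = 0. *)
Lemma first_order_term_eq0 (R : realFieldType) (b c : R) :
  0 <= b -> (forall t, 0 <= t ^+ 2 * b + 2 * t * c) -> c = 0.
Proof.
move=> b0 /(_ (- c / (b + 1))) hc.
have b1 : 0 < b + 1 by lra.
have hE : (- c / (b + 1)) ^+ 2 * b + 2 * (- c / (b + 1)) * c =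
    - (c ^+ 2 * ((b + 2) / (b + 1) ^+ 2)) by field; exact: lt0r_neq0.
move: hc; rewrite hE oppr_ge0 pmulr_lle0; last first.
  by rewrite divr_gt0 ?exprn_gt0//; lra.
by move=> c2; apply/eqP; rewrite -sqrf_eq0 eq_le c2 sqr_ge0.
Qed.

(** The representer minimizes the energy J w = (w, w) - 2 phi w.  J is bounded below by
coercivity, the parallelogram identity makes a minimizing sequence Cauchy, and its
limit satisfies the Euler-Lagrange equation L w = phi. *)
Lemma riesz_preconditioner (R : realType) (H : completeNormedModType R)
    (L : H -> H -> R) (phi : H -> R) :
  preconditioner L -> bounded_functional phi -> exists w, L w = phi.
Proof.
move=> hL [lphi [M hM]].
have phiD x y : phi (x + y) = phi x + phi y.
  by have := lphi 1 x y; rewrite scale1r mul1r.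
have phi0 : phi 0 = 0 by apply: (addrI (phi 0)); rewrite -phiD !addr0.
have phiZ a x : phi (a *: x) = a * phi x.
  by have := lphi a x 0; rewrite /= phi0 !addr0.
have [_ _ _ [C C0 hC]] := hL.
pose J w := L w w - 2 * phi w.
have J_lb : lbound (range J) (- (M ^+ 2 / C)).
  move=> _ [w _ <-]; rewrite /J.
  have := hC w; have : phi w <= M * `|w| := le_trans (ler_norm _) (hM w).
  suff : - (M ^+ 2 / C) <= C * `|w| ^+ 2 - 2 * (M * `|w|) by lra.
  rewrite -subr_ge0.
  rewrite (_ : _ - _ = (C * `|w| - M) ^+ 2 / C); last by field; exact: lt0r_neq0.
  by rewrite divr_ge0 ?sqr_ge0// ltW.
have J_inf : has_inf (range J).
  by split; [exists (J 0), 0|exists (- (M ^+ 2 / C))].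
set m := inf (range J).
have m_le w : m <= J w by apply: ge_inf; [case: J_inf|exists w].
have /choice[w hw] n : exists w, J w < m + n.+1%:R^-1.
  have n0 : 0 < n.+1%:R^-1 :> R by rewrite invr_gt0.
  by have [_ [x _ <-] ?] := inf_adherent n0 J_inf; exists x.
have parallelogram x y :
    L (x - y) (x - y) = 2 * J x + 2 * J y - 4 * J (2^-1 *: (x + y)).
  rewrite /J phiZ phiD !(preconditioner_expand hL) (preconditionerC hL y x).
  by field.
have w_close n k : (n <= k)%N -> C * `|w n - w k| ^+ 2 <= 4 * n.+1%:R^-1.
  move=> nk; apply: le_trans (hC _) _; rewrite parallelogram.
  have kn : k.+1%:R^-1 <= n.+1%:R^-1 :> R by rewrite lef_pV2 ?posrE// ler_nat.
  move: kn (hw n) (hw k) (m_le (2^-1 *: (w n + w k))).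
  move: n.+1%:R^-1 k.+1%:R^-1 (J _) (J _) (J _) => a b p q r; lra.
have w_cvg : cvg (w @ \oo).
  apply/cauchy_cvgP/cauchy_exP => e e0.
  have d0 : 0 < C * e ^+ 2 / 4 by rewrite divr_gt0 ?mulr_gt0 ?exprn_gt0.
  near \oo => n; exists (w n); exists n => // k /= nk.
  rewrite -ball_normE /= -ltr_sqr ?nnegrE ?(ltW e0)//.
  rewrite -(ltr_pM2l C0) (le_lt_trans (w_close _ _ nk))//.
  rewrite mulrC -ltr_pdivlMr//.
  by near: n; exact: (near_infty_natSinv_lt (PosNum d0)).
set z := lim (w @ \oo).
exists z; apply/funext => h.
apply/eqP; rewrite -subr_eq0; apply/eqP.
apply: (first_order_term_eq0 (preconditioner_ge0 hL h)) => t.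
have w_ge n : - n.+1%:R^-1 <= t ^+ 2 * L h h + 2 * t * (L (w n) h - phi h).
  have := m_le (w n + t *: h); have := hw n.
  rewrite /J phiD phiZ !(preconditioner_expand hL) (preconditionerC hL h (w n)).
  move: n.+1%:R^-1 => a; lra.
(* The first-order condition holds along the sequence up to 1 / (n + 1); each side
   is continuous in w n, so it passes to the limit. *)
have Lh_cont : continuous (L ^~ h).
  move=> x; rewrite (_ : L ^~ h = L h).
    exact: (bounded_functional_continuous (bounded_functional_preconditioner hL h)).
  by apply/funext => y; exact: preconditionerC hL y h.
have lhs_cvg : (fun n : nat => - n.+1%:R^-1 : R) @ \oo --> (0 : R).
  by rewrite -oppr0; apply: cvgN; exact: cvg_harmonic.
have rhs_cvg : (fun n => t ^+ 2 * L h h + 2 * t * (L (w n) h - phi h)) @ \oo -->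
    t ^+ 2 * L h h + 2 * t * (L z h - phi h).
  apply: cvgD; first exact: cvg_cst.
  apply: cvgM; first exact: cvg_cst.
  apply: cvgB; last exact: cvg_cst.
  exact: (cvg_comp _ _ w_cvg (Lh_cont z)).
rewrite -(cvg_lim (@Rhausdorff R) lhs_cvg) -(cvg_lim (@Rhausdorff R) rhs_cvg).
apply: ler_lim; [exact: cvgP lhs_cvg|exact: cvgP rhs_cvg|].
by near=> n; exact: w_ge.
Unshelve. all: by end_near. Qed.

(** * The dual trap inequality and one perturbed step *)

(** Expanding the square on the left gives
(1 + mu / Lhat) (g, e) >= (mu / 2 + mu^2 / (4 Lhat)) |e|^2 + |g|^2 / Lhat,
and dividing by 1 + mu / Lhat produces the two constants. *)
Lemma cocoercivity_dual_trap (R : realType) (H : normedModType R)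
    (L : H -> H -> R) (mu Lhat : R) (e g : H) :
  preconditioner L -> 0 < mu -> 0 < Lhat ->
  1 / Lhat * L (g - (mu / 2) *: e) (g - (mu / 2) *: e)
    <= L (g - (mu / 2) *: e) e ->
  dual_trap1 mu Lhat * L e e + dual_trap2 mu Lhat * L g g <= L g e.
Proof.
move=> hL mu0 Lh0; rewrite !(preconditioner_expand hL) (preconditionerC hL e g).
move: (L e e) (L g e) (L g g) => a b c.
rewrite div1r ler_pdivrMl// /dual_trap1 /dual_trap2 => cocoercive.
have s0 : 0 < mu + Lhat by rewrite addr_gt0.
rewrite (_ : _ + _ = ((mu ^+ 2 / 4 + mu * Lhat / 2) * a + c) / (mu + Lhat)).
  by rewrite ler_pdivrMr//; lra.
field.
by rewrite !lt0r_neq0// addr_gt0// mulr_gt0.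
Qed.

(** The unperturbed step contracts by 1 - beta C1, and the perturbation can move the
iterate back by at most beta C1 d. *)
Lemma perturbed_step_in_ball (R : realType) (H : normedModType R)
    (L : H -> H -> R) (C1 C2 beta d : R) (e g p : H) :
  preconditioner L -> 0 < C1 -> 0 < beta -> beta <= C2 -> beta <= C1^-1 ->
  C1 * L e e + C2 * L g g <= L g e ->
  Lnorm_primal L e <= d -> Lnorm_primal L p <= C1 * d ->
  Lnorm_primal L (e - beta *: (g + p)) <= d.
Proof.
move=> hL C10 beta0 betaC2 betaC1 trap ed pd.
have {}betaC1 : 0 <= 1 - beta * C1.
  by rewrite subr_ge0 -ler_pdivlMr// div1r.
have exact_step :
    Lnorm_primal L (e - beta *: g) <= (1 - beta * C1) * Lnorm_primal L e.
  rewrite -ler_sqr ?nnegrE ?mulr_ge0 ?sqrtr_ge0// exprMn.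
  rewrite !(Lnorm_primal_sqr hL) !(preconditioner_expand hL).
  rewrite (preconditionerC hL e g).
  have ee := preconditioner_ge0 hL e; have gg := preconditioner_ge0 hL g.
  move: (L e e) (L g e) (L g g) trap ee gg => a b c trap a0 c0.
  (* The difference of the two sides is 2 h1 + h2 + h3 + h4: the dual trap
     inequality, the absorption of beta^2 |g|^2, and the square completing
     1 - 2 beta C1 to (1 - beta C1)^2. *)
  have h1 : 0 <= beta * (b - (C1 * a + C2 * c)).
    by rewrite mulr_ge0 ?subr_ge0// ltW.
  have h2 : 0 <= beta * (C2 - beta) * c.
    by rewrite !mulr_ge0 ?subr_ge0// ltW.
  have h3 : 0 <= beta * C2 * c.
    by rewrite !mulr_ge0 ?(ltW beta0)// (le_trans (ltW beta0)).
  have h4 : 0 <= (beta * C1) ^+ 2 * a by rewrite mulr_ge0 ?sqr_ge0.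
  by lra.
rewrite scalerDr opprD addrA; apply: le_trans (Lnorm_primalB hL _ _) _.
rewrite (Lnorm_primalZ hL) gtr0_norm//.
apply: (@le_trans _ _ ((1 - beta * C1) * d + beta * (C1 * d))); last by lra.
apply: lerD; last by rewrite ler_pM2l.
by apply: le_trans exact_step _; rewrite ler_wpM2l.
Qed.

Section DualTrapConstants.
Context {R : realType} {mu Lhat : R}.
Context (mu0 : 0 < mu) (Lhat0 : 0 < Lhat).

Lemma dual_trap1_gt0 : 0 < dual_trap1 mu Lhat.
Proof.
by rewrite /dual_trap1 divr_gt0// addr_gt0// ?mulr_gt0// exprn_gt0.
Qed.

Lemma dual_trap2_gt0 : 0 < dual_trap2 mu Lhat.
Proof. by rewrite /dual_trap2 divr_gt0// addr_gt0. Qed.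

End DualTrapConstants.

Lemma perturbation_threshold_gt0 (R : realType) (C1 C2 d : R) :
  0 < C1 -> 0 < C2 -> 0 < d ->
  0 < (1 / C1 + 5 * C2 / 4)^-1 * d ^+ 2 * C1.
Proof.
move=> C10 C20 d0; apply: mulr_gt0 => //; apply: mulr_gt0; last exact: exprn_gt0.
by rewrite invr_gt0 addr_gt0// divr_gt0// mulr_gt0.
Qed.

(** Dropping the term in C2 from the sum only enlarges its inverse, to C1. *)
Lemma perturbation_threshold_le (R : realType) (C1 C2 d : R) :
  0 < C1 -> 0 < C2 ->
  (1 / C1 + 5 * C2 / 4)^-1 * d ^+ 2 * C1 <= (C1 * d) ^+ 2.
Proof.
move=> C10 C20.
rewrite (_ : (C1 * d) ^+ 2 = C1 * d ^+ 2 * C1); last by rewrite exprMn; ring.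
apply: ler_wpM2r; first exact: ltW.
apply: ler_wpM2r; first exact: sqr_ge0.
rewrite -[leRHS]invrK lef_pV2 ?posrE ?invr_gt0//.
  by rewrite div1r lerDl divr_ge0// mulr_ge0// ltW.
by rewrite addr_gt0// !divr_gt0// mulr_gt0.
Qed.

(** * Invariance of the ball under the iteration *)

Section PPGDStep.
Context {R : realType} {H : completeNormedModType R}.
Context {L : H -> H -> R} {mu Lhat : R} {G : H -> R} {u : H} {d : R}.
Context (hL : preconditioner L) (mu0 : 0 < mu).
Context (dG : forall v, differentiable (G : H -> R^o) v).
Context (hu : minimizer G u) (d0 : 0 <= d).
Let B := [set v : H | Lnorm_primal L (v - u) <= d].
Context (cocoercive : cocoercivity_constant L mu G B Lhat).

(** The gradient at u vanishes, so the representer g of the gradient at v also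
represents the difference of the two gradients. *)
Lemma gradient_dual_trap (v g : H) : B v -> deriv G v = L g ->
  dual_trap1 mu Lhat * L (v - u) (v - u) + dual_trap2 mu Lhat * L g g
    <= L g (v - u).
Proof.
move=> Bv gE; have [Lhat0 hcoc] := cocoercive.
apply: cocoercivity_dual_trap => //.
have Bu : B u by rewrite /B /= subrr (Lnorm_primal0 hL).
have gtildeE : deriv (Gtilde L mu G) v \- deriv (Gtilde L mu G) u =
    L (g - (mu / 2) *: (v - u)).
  rewrite !(deriv_Gtilde hL)// (deriv_minimizer dG hu) gE.
  apply/funext => h /=; rewrite scalerBr !(preconditioner_expand hL).
  by rewrite sub0r; ring.
have := hcoc v u Bv Bu; cbv zeta; rewrite gtildeE.
by rewrite (Lnorm_dualE hL) (Lnorm_primal_sqr hL).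
Qed.

Lemma ppgd_step_in_ball (beta : R) (v : H) (eta : H -> R) :
  0 < beta <= Num.min (dual_trap2 mu Lhat) (dual_trap1 mu Lhat)^-1 ->
  bounded_functional eta ->
  Lnorm_dual L eta ^+ 2 <=
    (1 / dual_trap1 mu Lhat + 5 * dual_trap2 mu Lhat / 4)^-1 * d ^+ 2 *
      dual_trap1 mu Lhat ->
  B v -> B (v - beta *: Linv L (deriv G v \+ eta)).
Proof.
move=> /andP[beta0]; rewrite le_min => /andP[betaC2 betaC1] heta eta_small Bv.
have [Lhat0 _] := cocoercive.
have C10 := dual_trap1_gt0 mu0 Lhat0; have C20 := dual_trap2_gt0 mu0 Lhat0.
have [g gE] := riesz_preconditioner hL (bounded_functional_deriv (dG v)).
have [p pE] := riesz_preconditioner hL heta.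
have -> : deriv G v \+ eta = L (g + p).
  by apply/funext => h /=; rewrite (preconditionerDl hL) gE pE.
rewrite (LinvK hL) /B /= addrAC.
apply: (perturbed_step_in_ball hL C10 beta0 betaC2 betaC1) => //.
  exact: gradient_dual_trap.
rewrite -ler_sqr ?nnegrE ?sqrtr_ge0 ?(mulr_ge0 (ltW C10) d0)//.
rewrite -(Lnorm_dualE hL) pE; apply: le_trans eta_small _.
exact: perturbation_threshold_le.
Qed.

End PPGDStep.

Theorem theorem3p3 (R : realType) (H : completeNormedModType R)
  (ip : {dot H for (@idfun R)}) (hip : norm_of_inner_product ip)
  (hsep : separable_space H)
  (L : H -> H -> R) (hL : preconditioner L)
  (E F : H -> R)
  (hE : continuously_differentiable E) (hF : continuously_differentiable F)
  (mu : R) (hmu : 0 < mu)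
  (hG : strongly_convex L mu (E \+ F))
  (hGL : locally_lipschitz_deriv L (E \+ F))
  (Theta : Type) (leT : Theta -> Theta -> Prop) (hT : directed_set leT)
  (A : Theta -> H -> H -> R) (hA : forall theta, bounded_operator (A theta))
  (hvan : uniformly_vanish L leT A F)
  (v0 u : H) (hu : minimizer (E \+ F) u)
  (Lhat beta : R) :
  let G := E \+ F in
  let d0 := Lnorm_primal L (v0 - u) in
  let B := [set v : H | Lnorm_primal L (v - u) <= d0] in
  let CB1 := dual_trap1 mu Lhat in
  let CB2 := dual_trap2 mu Lhat in
  let beta0 := Num.min CB2 CB1^-1 in
  let eps0 := (1 / CB1 + 5 * CB2 / 4)^-1 * d0 ^+ 2 * CB1 in
  let v := ppgd L G F A beta v0 in
  let eta := fun theta k => perturbation A F (v theta k) (theta k) in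
  cocoercivity_constant L mu G B Lhat ->
  0 < beta <= beta0 ->
  (forall theta : nat -> Theta,
     (forall k, Lnorm_dual L (eta theta k) ^+ 2 <= eps0) ->
     forall k, B (v theta k)) /\
  (0 < d0 -> exists theta : nat -> Theta,
     forall k, Lnorm_dual L (eta theta k) ^+ 2 <= eps0).
Proof.
move=> G d0 B CB1 CB2 beta0 eps0 v eta hcoc hbeta.
have d0_ge0 : 0 <= d0 by exact: sqrtr_ge0.
have dG x : differentiable (G : H -> R^o) x.
  by apply: differentiableD; [case: hE|case: hF].
have bounded_perturbation x theta : bounded_functional (perturbation A F x theta).
  apply: bounded_functionalB.
    have [[_ lA] [M hM]] := hA theta.
    by split; [exact: lA|exists (M * `|x|)].
  by apply: bounded_functional_deriv; case: hF.
have B_step theta k : Lnorm_dual L (eta theta k) ^+ 2 <= eps0 ->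
    B (v theta k) -> B (v theta k.+1).
  exact: (ppgd_step_in_ball hL hmu dG hu d0_ge0 hcoc hbeta (bounded_perturbation _ _)).
have B0 theta : B (v theta 0) by rewrite /B /=.
split=> [theta small|d0_gt0].
  by elim=> [|k IHk]; [exact: B0|exact: B_step].
have [Lhat0 _] := hcoc.
have C10 : 0 < CB1 by exact: dual_trap1_gt0.
have C20 : 0 < CB2 by exact: dual_trap2_gt0.
have eps0_gt0 : 0 < eps0 by exact: perturbation_threshold_gt0.
have seps0 : 0 < Num.sqrt eps0 by rewrite sqrtr_gt0.
have [theta0 htheta0] := hvan B _ (bounded_Lnorm_ball hL u d0) seps0.
have [_ leTT _ _] := hT.
have small x : B x -> Lnorm_dual L (perturbation A F x theta0) ^+ 2 <= eps0.
  move=> Bx; rewrite -[leRHS]sqr_sqrtr ?(ltW eps0_gt0)//.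
  rewrite ler_sqr ?nnegrE ?sqrtr_ge0// -lee_fin.
  apply: le_trans (htheta0 theta0 (leTT theta0)).
  by apply: ereal_sup_ubound; exists x.
pose theta (k : nat) := theta0.
suff Bv k : B (v theta k) by exists theta => k; exact: small.
by elim: k => [|k IHk]; [exact: B0|apply: B_step => //; exact: small].
Qed.
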